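(* Let $n\ge 1$ and let $nK_4$ denote the disjoint union of $n$ copies of the complete graph $K_4$. Then $S(nK_4)=s$, where $s$ is the positive integer such that $$\binom{\lfloor\frac{s-1}{2}\rfloor}{3}+\binom{\lceil\frac{s-1}{2}\rceil}{3}<n\le\binom{\lfloor\frac{s}{2}\rfloor}{3}+\binom{\lceil\frac{s}{2}\rceil}{3}.$$
   Context: For a finite simple graph $G=(V,E)$ and an injective map $f:V\to\mathbb Z$, let $\sigma(G,f)=\{f(v)+f(w): vw\in E\}$. The sum index of $G$ is $S(G)=\min_{f}|\sigma(G,f)|$ over all injective $f:V\to\mathbb Z$. Binomial coefficients $\binom{a}{3}$ are $0$ when $a<3$. *)

(* Defs.v *)
From HB Require Import structures.
From mathcomp Require Import all_boot all_order all_algebra.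
From mathcomp Require Import finmap.
From mathcomp Require Import boolp.

Set Implicit Arguments.
Unset Strict Implicit.
Unset Printing Implicit Defensive.

Record sgraph := SGraph {
  vertex :> finType;
  adj : rel vertex;
  adj_sym : symmetric adj;
  adj_irrefl : irreflexive adj }.

Section CompleteGraph.
Variable m : nat.

Definition complete_adj : rel 'I_m := fun x y => x != y.

Lemma complete_adj_sym : symmetric complete_adj.
Proof. by move=> x y; rewrite /complete_adj eq_sym. Qed.

Lemma complete_adj_irrefl : irreflexive complete_adj.
Proof. by move=> x; rewrite /complete_adj eqxx. Qed.

Definition complete_graph : sgraph :=
  SGraph complete_adj_sym complete_adj_irrefl.
End CompleteGraph.

Section Copies.
Variables (n : nat) (G : sgraph).

Definition copies_adj : rel ('I_n * G)%type :=
  fun x y => (x.1 == y.1) && adj x.2 y.2.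

Lemma copies_adj_sym : symmetric copies_adj.
Proof. by move=> x y; rewrite /copies_adj eq_sym adj_sym. Qed.

Lemma copies_adj_irrefl : irreflexive copies_adj.
Proof. by move=> x; rewrite /copies_adj adj_irrefl andbF. Qed.

Definition copies : sgraph := SGraph copies_adj_sym copies_adj_irrefl.
End Copies.

Section SumIndex.
Variable G : sgraph.

Definition sum_set (f : G -> int) : {fset int} :=
  [fset (f p.1 + f p.2)%R | p in [pred p : G * G | adj p.1 p.2]]%fset.

Definition sum_set_size (k : nat) : Prop :=
  exists f : G -> int, injective f /\ #|` sum_set f| = k.

Lemma sum_set_size_exists : exists k, `[< sum_set_size k >].
Proof.
pose f (v : G) : int := Posz (enum_rank v).
exists #|` sum_set f|; apply/asboolP; exists f; split=> //.
by move=> x y [] /ord_inj /enum_rank_inj.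
Qed.

Definition sum_index : nat := ex_minn sum_set_size_exists.

Lemma sum_indexP (s : nat) :
  sum_index = s <->
  (exists f : G -> int, injective f /\ #|` sum_set f| = s) /\
  (forall f : G -> int, injective f -> s <= #|` sum_set f|).
Proof.
rewrite /sum_index; case: ex_minnP => m /asboolP[f [fi fm]] mmin; split.
- move=> <-; split; first by exists f.
  by move=> g gi; apply: mmin; apply/asboolP; exists g.
- case=> [[g [gi gs]] smin]; apply/eqP; rewrite eqn_leq -{2}fm smin // andbT.
  by apply: mmin; apply/asboolP; exists g.
Qed.
End SumIndex.

Lemma mem_sum_set (G : sgraph) (f : G -> int) (z : int) :
  reflect (exists v w : G, adj v w /\ z = (f v + f w)%R) (z \in sum_set f).
Proof.
apply: (iffP (imfsetP _ _ _ _)) => [[[v w] /= vw ->]|[v [w [vw ->]]]].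
- by exists v, w.
- by exists (v, w).
Qed.

(* Main.v *)
(** Lower bound: split the [s] edge sums into the [s./2] smallest and the
    [uphalf s] largest.  In a copy of K4 with labels a < b < c < d, either b + c
    is a small sum, and so are all sums of the triangle abc, or b + c is a large
    sum, and so are all sums of the triangle bcd.  The three sums of a triangle
    determine its labels, hence the copy, so distinct copies yield distinct
    3-subsets of one of the two halves.

    Construction: let w_0 = 0 and w_i = 3^i for i > 0.  For three indices i, j, k,
    the four sums ±w_i ± w_j ± w_k with a prescribed parity of the number of
    minus signs label a K4 with edge sums ±2w_i, ±2w_j, ±2w_k: two sign patterns
    of the same parity agree at exactly one index.  All labels are distinct by
    uniqueness of balanced ternary expansions.  The index 0 is used only when [s]
    is odd, and then for one parity only, because the sign of w_0 leaves no trace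
    in the label. *)

Require Import Defs.
From HB Require Import structures.
From mathcomp Require Import all_boot all_order all_algebra.
From mathcomp Require Import finmap.
From mathcomp Require Import boolp.
From mathcomp Require Import zify lra.

Set Implicit Arguments.
Unset Strict Implicit.
Unset Printing Implicit Defensive.

Import Order.TTheory GRing.Theory Num.Theory.

Lemma sum_index_leqP (G : sgraph) (s : nat) :
  sum_index G <= s <->
  exists2 f : G -> int, injective f & #|` sum_set f| <= s.
Proof.
have [[f [f_inj f_card]] f_min] := (sum_indexP G (sum_index G)).1 erefl.
split=> [le_s|[g /f_min le_g]]; last exact: leq_trans.
by exists f; rewrite ?f_card.
Qed.

Lemma mem_sum_set_adj (G : sgraph) (f : G -> int) (v w : G) :
  adj v w -> (f v + f w)%R \in sum_set f.
Proof. by move=> vw; apply/mem_sum_set; exists v, w. Qed.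

Lemma adj_copies_complete n k (i j : 'I_n) (v w : 'I_k) :
  @adj (copies n (complete_graph k)) (i, v) (j, w) = (i == j) && (v != w).
Proof. by []. Qed.

Definition half_triples (s : nat) : nat := 'C(s./2, 3) + 'C(uphalf s, 3).

Lemma half_triples_homo : {homo half_triples : s t / s <= t}.
Proof.
by move=> s t st; rewrite leq_add // leq_bin2l // ?half_leq ?uphalf_leq.
Qed.

Section SidedSubsets.
Variables (T : finType) (half : bool -> {set T}) (k : nat).

Definition sided_subsets : {set bool * {set T}} :=
  [set p : bool * {set T} | (p.2 \subset half p.1) && (#|p.2| == k)].

Lemma card_sided_subsets :
  #|sided_subsets| = 'C(#|half true|, k) + 'C(#|half false|, k).
Proof.
transitivity (\sum_side #|[set A : {set T} | A \subset half side & #|A| == k]|).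
  under eq_bigr do rewrite -sum1dep_card.
  by rewrite pair_big_dep sum1dep_card.
by rewrite big_bool !cards_draws.
Qed.

End SidedSubsets.

Section TriangleSums.
Variable R : realDomainType.
Local Open Scope ring_scope.

Definition triangle_sums (a b c : R) : seq R := [:: a + b; a + c; b + c].

Lemma triangle_sums_sorted a b c : a < b -> b < c ->
  sorted <%R (triangle_sums a b c).
Proof. by move=> ab bc; rewrite /= ltrD2l ltrD2r bc ab. Qed.

Lemma triangle_sums_inj a b c a' b' c' :
  a < b -> b < c -> a' < b' -> b' < c' ->
  triangle_sums a b c =i triangle_sums a' b' c' -> a = a'.
Proof.
move=> ab bc ab' bc' eq_sums.
have [eq_ab eq_ac eq_bc] := lt_sorted_eq (triangle_sums_sorted ab bc)
  (triangle_sums_sorted ab' bc') eq_sums.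
lra.
Qed.

Lemma exists_one_sided_triangle (g : 'I_4 -> R) (t : R) : injective g ->
  exists p q r side, [/\ g p < g q, g q < g r
    & all (fun z => (z < t) == side) (triangle_sums (g p) (g q) (g r))].
Proof.
move=> g_inj; pose vs := sort (relpre g <=%R) (enum 'I_4).
have : sorted (relpre g <%R) vs.
  by rewrite -sorted_map -sort_map sort_lt_sorted map_inj_uniq ?enum_uniq.
have : size vs = 4 by rewrite size_sort size_enum_ord.
case: vs => [|a [|b [|c [|d [|]]]]] //= _ /and4P[ab bc cd _].
have [bc_small|bc_large] := ltP (g b + g c) t.
- exists a, b, c, true; rewrite /= !eqb_id; split=> //.
  by apply/and4P; split=> //; lra.
- exists b, c, d, false; rewrite /= !eqbF_neg -!leNgt; split=> //.
  by apply/and4P; split=> //; lra.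
Qed.

End TriangleSums.

Lemma exists_fset_threshold d (T : orderType d) (S : {fset T}) (k : nat) :
  k < #|` S| -> exists t, forall side,
    #|` [fset x in S | (x < t)%O == side]%fset| =
      if side then k else #|` S| - k.
Proof.
case: (fset_0Vmem S) => [->|[x0 _]] k_lt; first by rewrite cardfs0 in k_lt.
pose t := nth x0 (sort <=%O S) k; exists t.
have count_below : count (< t)%O S = k.
  rewrite -(count_sort <=%O) count_lt_nth ?sort_lt_sorted ?size_sort //.
  exact: fset_uniq.
have card_sep (P : pred T) : #|` [fset x in S | P x]%fset| = count P S.
  by rewrite card_imfset //= size_filter.
case; rewrite card_sep.
  by rewrite -[RHS]count_below; apply: eq_count => x; rewrite eqb_id.
rewrite -count_below -(count_predC (< t)%O S) addKn.
by apply: eq_count => x; rewrite eqbF_neg.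
Qed.

Section CopiesOfK4.
Variables (n : nat) (f : copies n (complete_graph 4) -> int).
Hypothesis f_inj : injective f.
Local Notation S := (sum_set f).
Local Open Scope fset_scope.
Local Open Scope ring_scope.

Definition copy_triangle_sums (i : 'I_n) (X : {fset int}) : Prop :=
  exists p q r, [/\ f (i, p) < f (i, q), f (i, q) < f (i, r)
    & X = [fset z in triangle_sums (f (i, p)) (f (i, q)) (f (i, r))]].

Lemma card_copy_triangle_sums i X : copy_triangle_sums i X -> #|` X| = 3%N.
Proof.
case=> [p [q [r [pq qr ->]]]]; rewrite card_fseq undup_id //.
exact: lt_sorted_uniq (triangle_sums_sorted pq qr).
Qed.

Lemma copy_triangle_sums_inj i j X :
  copy_triangle_sums i X -> copy_triangle_sums j X -> i = j.
Proof.
move=> [p [q [r [pq qr ->]]]] [p' [q' [r' [pq' qr' /fsetP eq_sums]]]].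
have /f_inj[] // : f (i, p) = f (j, p').
apply: triangle_sums_inj pq qr pq' qr' _ => z.
by move: (eq_sums z); rewrite !in_fset.
Qed.

Lemma exists_one_sided_copy_triangle (t : int) (i : 'I_n) : exists side X,
  copy_triangle_sums i X /\ X `<=` [fset x in S | (x < t) == side].
Proof.
have fi_inj : injective (fun v => f (i, v)) by move=> v w /f_inj [].
have [p [q [r [side [pq qr /allP sums_side]]]]] :=
  exists_one_sided_triangle t fi_inj.
exists side, [fset z in triangle_sums (f (i, p)) (f (i, q)) (f (i, r))].
split; first by exists p, q, r.
apply/fsubsetP => z; rewrite !in_fset => z_sum.
apply/andP; split; last exact: sums_side.
have sum_in_S v w : f (i, v) < f (i, w) -> f (i, v) + f (i, w) \in S.
  move=> vw; apply: mem_sum_set_adj; rewrite adj_copies_complete eqxx /=.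
  by apply: contraTneq vw => ->; rewrite ltxx.
have pr := lt_trans pq qr.
by move: z_sum; rewrite !inE => /or3P[] /eqP->; apply: sum_in_S.
Qed.

Lemma card_sum_set_gt0 : (0 < n)%N -> (0 < #|` S|)%N.
Proof.
move=> n_gt0; rewrite cardfs_gt0; apply/fset0Pn; pose i := Ordinal n_gt0.
exists (f (i, ord0) + f (i, ord_max)).
by rewrite mem_sum_set_adj // adj_copies_complete eqxx.
Qed.

Lemma copies_leq_half_triples : (n <= half_triples #|` S|)%N.
Proof.
have [n0|n_gt0] := leqP n 0; first exact: leq_trans n0 _.
have [|t card_half] := @exists_fset_threshold _ _ S (#|` S|)./2.
  by rewrite ltn_half_double -muln2 ltn_Pmulr // card_sum_set_gt0.
pose half side := [fset x in S | (x < t) == side].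
have half_sub side : half side `<=` S by exact: fset_sub.
have -> : half_triples #|` S| =
    #|sided_subsets (fun side => fsub S (half side)) 3|.
  have sub_half m : (m - m./2 = uphalf m)%N by lia.
  by rewrite card_sided_subsets !card_fsub // !card_half sub_half.
have /fin_all_exists[A A_spec] i : exists A : bool * {fset int},
    copy_triangle_sums i A.2 /\ A.2 `<=` half A.1.
  by have [side [X]] := exists_one_sided_copy_triangle t i; exists (side, X).
pose triple i := ((A i).1, fsub S (A i).2).
have triple_inj : injective triple.
  move=> i j [_ eq_fsub]; apply: (copy_triangle_sums_inj (X := (A i).2)).
    exact: (A_spec i).1.
  rewrite (fsub_inj _ _ eq_fsub); first exact: (A_spec j).1.
  - exact: fsubset_trans (A_spec i).2 (half_sub _).
  - exact: fsubset_trans (A_spec j).2 (half_sub _).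
rewrite -[X in (X <= _)%N]card_ord -(card_codom triple_inj).
apply/subset_leq_card/subsetP => _ /codomP[i ->].
have [A_tri A_half] := A_spec i.
have A_sub := fsubset_trans A_half (half_sub _).
rewrite inE subset_fsubE // A_half card_fsub //.
by rewrite (card_copy_triangle_sums A_tri).
Qed.

End CopiesOfK4.

Section FinsetFacts.
Variable T : finType.
Implicit Types (A B : {set T}) (x : T).

Lemma eq_setD1 x A B : A :\ x = B :\ x -> (x \in A) = (x \in B) -> A = B.
Proof.
move=> /setP eqD1 eq_x; apply/setP => y; have [->//|y_neq] := eqVneq y x.
by have := eqD1 y; rewrite !inE y_neq.
Qed.

Lemma eq_setD1_odd x A B : A :\ x = B :\ x -> odd #|A| = odd #|B| -> A = B.
Proof.
move=> eqD1; rewrite (cardsD1 x A) (cardsD1 x B) eqD1 !oddD => /addIb.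
by rewrite !oddb; apply: eq_setD1.
Qed.

Lemma exists_inj_in_set A n : n <= #|A| ->
  exists2 h : 'I_n -> T, injective h & forall i, h i \in A.
Proof.
move=> n_le; exists (fun i => enum_val (widen_ord n_le i)) => [i j|i].
  by move=> /enum_val_inj[] /ord_inj.
exact: enum_valP.
Qed.

End FinsetFacts.

Section ParitySubsets.
Variable T : finType.
Implicit Types (A N : {set T}) (parity : bool).

Definition parity_subsets A parity : {set {set T}} :=
  [set N : {set T} | (N \subset A) && (odd #|N| == parity)].

Lemma card_parity_subsets A parity :
  A != set0 -> #|parity_subsets A parity| = 2 ^ #|A|.-1.
Proof.
case/set0Pn=> i iA; rewrite (cardsD1 i A) iA add1n /=.
pose count p := #|parity_subsets A p|; rewrite -/(count parity).
have count_leq p : count p <= 2 ^ #|A :\ i|.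
  rewrite /count -card_powerset.
  rewrite -(@card_in_imset _ _ (fun N => N :\ i) (parity_subsets A p)).
    apply/subset_leq_card/subsetP => _ /imsetP[N + ->].
    by rewrite !inE => /andP[NA _]; exact: setSD.
  move=> N N'; rewrite !inE => /andP[_ /eqP oddN] /andP[_ /eqP oddN'].
  by move/eq_setD1_odd; apply; rewrite oddN oddN'.
have : count true + count false = 2 ^ #|A|.
  rewrite -card_powerset -(cardsID [set N : {set T} | odd #|N|] (powerset A)).
  congr (_ + _); apply: eq_card => N; rewrite !inE ?eqb_id //.
  by rewrite eqbF_neg andbC.
rewrite (cardsD1 i A) iA expnS.
by have := count_leq true; have := count_leq false; case: parity; lia.
Qed.

Definition agreement A N N' : {set T} := [set i in A | (i \in N) == (i \in N')].

Lemma agreement_id A N N' : N \subset A -> N' \subset A ->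
  agreement A N N' = A -> N = N'.
Proof.
move=> NA N'A /setP agree; apply/setP => i; have := agree i; rewrite inE.
have [iA|iA _] := boolP (i \in A); first by move/eqP.
by rewrite (contraNF (subsetP NA i) iA) (contraNF (subsetP N'A i) iA).
Qed.

Lemma odd_card_agreement A N N' : N \subset A -> N' \subset A ->
  odd #|agreement A N N'| = odd #|A| (+) odd #|N| (+) odd #|N'|.
Proof.
move=> NA N'A.
have card_agree : #|agreement A N N'| = #|N :&: N'| + #|A :\: (N :|: N')|.
  rewrite -(cardsID N); congr (_ + _); apply: eq_card => i; rewrite !inE.
    have [iN|_] := boolP (i \in N); last by rewrite andbF.
    by rewrite (subsetP NA i iN) andbT.
  by case: (i \in N); rewrite //= eq_sym eqbF_neg andbC.
have := cardsUI N N'; have := cardsID (N :|: N') A.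
have UA : N :|: N' \subset A by rewrite subUset NA.
by rewrite (setIidPr UA); move: card_agree; lia.
Qed.

End ParitySubsets.

Section SignedSum.
Variables (I : finType) (R : pzRingType) (w : I -> R).
Implicit Types A N : {set I}.
Local Open Scope ring_scope.

Definition signed_sum A N : R := \sum_(i in A) (-1) ^+ (i \in N) * w i.

Lemma signed_sumD A N N' : signed_sum A N + signed_sum A N' =
  \sum_(i in agreement A N N') (-1) ^+ (i \in N) * w i *+ 2.
Proof.
rewrite -big_split /= (eq_bigl _ _ (fun i => in_set _ i)) big_mkcondr /=.
apply: eq_bigr => i _; rewrite -mulrDl -mulrnAl.
by case: (i \in N); case: (i \in N'); rewrite /= ?addNr ?subrr ?mul0r.
Qed.

Lemma signed_sumD_parity A parity N N' : #|A| = 3%N -> N != N' ->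
  N \in parity_subsets A parity -> N' \in parity_subsets A parity ->
  exists2 i, i \in A &
    signed_sum A N + signed_sum A N' = (-1) ^+ (i \in N) * w i *+ 2.
Proof.
move=> A3 neqN; rewrite !inE => /andP[NA /eqP oddN] /andP[N'A /eqP oddN'].
have agree_sub : agreement A N N' \subset A.
  by apply/subsetP => i; rewrite inE => /andP[].
have agree_lt3 : (#|agreement A N N'| < 3)%N.
  rewrite -A3 proper_card // properEneq agree_sub andbT.
  by apply: contraNneq neqN => /(agreement_id NA N'A)->.
have /cards1P[i agree_i] : #|agreement A N N'| == 1%N.
  have := odd_card_agreement NA N'A; rewrite A3 oddN oddN' addbK.
  by move: agree_lt3; case: #|_| => [|[|[|]]].
exists i; last by rewrite signed_sumD agree_i big_set1.
by apply: (subsetP agree_sub); rewrite agree_i inE.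
Qed.

End SignedSum.

Lemma small_digits_inj (b : int) m (d d' : 'I_m -> int) :
  (forall i, `|d i| *+ 2 < b)%R -> (forall i, `|d' i| *+ 2 < b)%R ->
  (\sum_i d i * b ^+ i = \sum_i d' i * b ^+ i)%R -> d =1 d'.
Proof.
elim: m d d' => [|m IH] d d' d_small d'_small; first by move=> _ [].
have horner_step (e : 'I_m.+1 -> int) : (\sum_i e i * b ^+ i =
    e ord0 + b * \sum_i e (lift ord0 i) * b ^+ i)%R.
  rewrite big_ord_recl expr0 mulr1 mulr_sumr; congr +%R.
  by apply: eq_bigr => i _; rewrite lift0 exprS mulrCA.
rewrite !horner_step => eq_sums.
(* The lowest digits differ by a multiple of b, and by less than b. *)
have eq_tails :
    (\sum_i d (lift ord0 i) * b ^+ i = \sum_i d' (lift ord0 i) * b ^+ i)%R.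
  by have := d_small ord0; have := d'_small ord0; nia.
move=> i; case: (unliftP ord0 i) => [j ->|->]; first exact: IH eq_tails j.
by move: eq_sums; rewrite eq_tails => /addIr.
Qed.

Definition ternary_weight (i : nat) : int := (if i == 0 then 0 else 3 ^+ i)%R.

Definition ternary_sum m (A N : {set 'I_m}) : int :=
  signed_sum (fun i : 'I_m => ternary_weight i) A N.

Lemma ternary_sum_eq_setD1 m (A N A' N' : {set 'I_m.+1}) :
  N \subset A -> N' \subset A' -> ternary_sum A N = ternary_sum A' N' ->
  A :\ ord0 = A' :\ ord0 /\ N :\ ord0 = N' :\ ord0.
Proof.
move=> NA N'A'; pose digit (B M : {set 'I_m.+1}) (i : 'I_m.+1) : int :=
  (if (i \in B) && (i != ord0) then (-1) ^+ (i \in M) else 0)%R.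
have digit_small B M i : (`|digit B M i| *+ 2 < 3)%R.
  by rewrite /digit; case: (_ && _); rewrite ?normrX ?normrN1 ?expr1n ?normr0.
have digitE B M : ternary_sum B M = (\sum_i digit B M i * 3 ^+ i)%R.
  rewrite /ternary_sum /signed_sum big_mkcond; apply: eq_bigr => i _.
  rewrite /digit /ternary_weight -val_eqE /=; case: (i \in B) => /=.
    by case: eqP; rewrite ?mulr0 ?mul0r.
  by rewrite mul0r.
rewrite !digitE.
move/(small_digits_inj (digit_small A N) (digit_small A' N')) => eq_digits.
suff eq_mem i : i != ord0 -> (i \in A) = (i \in A') /\ (i \in N) = (i \in N').
  by split; apply/setP => i; rewrite !inE; case: eqP => //= /eqP /eq_mem[].
move=> i_neq0; have := eq_digits i; rewrite /digit i_neq0 !andbT.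
have /implyP := subsetP NA i; have /implyP := subsetP N'A' i.
by do 4!case: (i \in _).
Qed.

Definition block_support s (side : bool) : {set 'I_(s./2).+1} :=
  [set i | (i != ord0) || (odd s && ~~ side)].

Lemma card_block_support s side :
  #|block_support s side| = if side then s./2 else uphalf s.
Proof.
have -> : block_support s side =
    if odd s && ~~ side then setT else ~: [set ord0].
  by apply/setP => i; rewrite inE; case: ifP; rewrite !inE ?orbT ?orbF.
rewrite uphalf_half.
by case: side; case: (odd s); rewrite /= ?cardsT ?cardsC1 card_ord.
Qed.

(* The first component of a block is the parity of the number of minus signs in
   its labels. *)
Definition blocks s : {set bool * {set 'I_(s./2).+1}} :=
  sided_subsets (block_support s) 3.

Lemma card_blocks s : #|blocks s| = half_triples s.
Proof. by rewrite card_sided_subsets !card_block_support. Qed.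

Lemma block_ternary_sum_inj s (b b' : bool * {set 'I_(s./2).+1}) N N' :
  b \in blocks s -> b' \in blocks s ->
  N \in parity_subsets b.2 b.1 -> N' \in parity_subsets b'.2 b'.1 ->
  ternary_sum b.2 N = ternary_sum b'.2 N' -> b = b' /\ N = N'.
Proof.
case: b b' => [side A] [side' A']; rewrite !inE /=.
move=> /andP[A_supp /eqP A3] /andP[A'_supp /eqP A'3].
move=> /andP[NA /eqP oddN] /andP[N'A' /eqP oddN'].
case/(ternary_sum_eq_setD1 NA N'A') => eqA1 eqN1.
have eqA : A = A' by apply: eq_setD1_odd eqA1 _; rewrite A3 A'3.
rewrite -{}eqA in N'A' A'_supp *.
have [A0|A0] := boolP (ord0 \in A).
  have side_false c : A \subset block_support s c -> c = false.
    by move/subsetP/(_ _ A0); rewrite inE => /andP[_ /negbTE].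
  have side0 := side_false _ A_supp; have side'0 := side_false _ A'_supp.
  rewrite side0 side'0; split=> //; apply: eq_setD1_odd eqN1 _.
  by rewrite oddN oddN' side0 side'0.
have eqN : N = N'.
  apply: eq_setD1 eqN1 _.
  by rewrite (contraNF (subsetP NA _) A0) (contraNF (subsetP N'A' _) A0).
by rewrite -oddN -oddN' eqN.
Qed.

Definition block_sums s : {fset int} :=
  let weight2 (i : 'I_(s./2).+1) : int := (ternary_weight i *+ 2)%R in
  ([fset weight2 i | i in block_support s false] `|`
   [fset (- weight2 i)%R | i in block_support s true])%fset.

Lemma card_block_sums s : #|` block_sums s| <= s.
Proof.
have card_image side (g : 'I_(s./2).+1 -> int) :
    #|` [fset g i | i in block_support s side]%fset| <= #|block_support s side|.
  by rewrite (leq_trans (leq_imfset_card _ _ _)) // cardE.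
apply: leq_trans (_ : uphalf s + s./2 <= s); last by lia.
rewrite cardfsU (leq_trans (leq_subr _ _)) // leq_add //.
  by rewrite (leq_trans (card_image _ _)) ?card_block_support.
by rewrite (leq_trans (card_image _ _)) ?card_block_support.
Qed.

Lemma mem_block_sums s side (i : 'I_(s./2).+1) (sign : bool) :
  i \in block_support s side ->
  ((-1) ^+ sign * ternary_weight i *+ 2)%R \in block_sums s.
Proof.
move=> i_supp; rewrite inE; have [i_eq0|i_neq0] := eqVneq i ord0.
  move: i_supp; rewrite i_eq0 inE /= mulr0 mul0rn => /andP[odd_s _].
  by apply/orP; left; apply/imfsetP; exists ord0; rewrite //= inE odd_s.
have i_supp_all b : i \in block_support s b by rewrite inE i_neq0.
apply/orP; case: sign; [right|left]; apply/imfsetP; exists i;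
  by rewrite ?mulN1r ?mul1r ?mulNrn //=.
Qed.

Lemma ternary_sumD_block s (b : bool * {set 'I_(s./2).+1}) N N' :
  b \in blocks s -> N != N' ->
  N \in parity_subsets b.2 b.1 -> N' \in parity_subsets b.2 b.1 ->
  (ternary_sum b.2 N + ternary_sum b.2 N')%R \in block_sums s.
Proof.
rewrite inE => /andP[/subsetP b_supp /eqP b3] neqN N_in N'_in.
have [i ib ->] := signed_sumD_parity
  (fun i : 'I_(s./2).+1 => ternary_weight i) b3 neqN N_in N'_in.
exact: mem_block_sums (b_supp i ib).
Qed.

Lemma exists_labeling_leq n s : n <= half_triples s ->
  exists2 f : copies n (complete_graph 4) -> int,
    injective f & #|` sum_set f| <= s.
Proof.
rewrite -card_blocks => /exists_inj_in_set[b b_inj b_in].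
have card_b i : #|(b i).2| = 3.
  by have := b_in i; rewrite inE => /andP[_ /eqP].
have /fin_all_exists2[N N_inj N_in] i : exists2 N : 'I_4 -> {set 'I_(s./2).+1},
    injective N & forall v, N v \in parity_subsets (b i).2 (b i).1.
  apply: exists_inj_in_set; rewrite card_parity_subsets ?card_b //.
  by rewrite -card_gt0 card_b.
exists (fun v => ternary_sum (b v.1).2 (N v.1 v.2)).
  move=> [i v] [j w] /= /block_ternary_sum_inj[] // /b_inj eq_ij.
  by rewrite -{j}eq_ij => /N_inj ->.
apply: leq_trans (card_block_sums s); apply: fsubset_leq_card.
apply/fsubsetP=> _ /mem_sum_set [[i v] [[j w] [vw ->]]] /=.
move: vw; rewrite adj_copies_complete -(inj_eq (N_inj i)) => /andP[/eqP <- vw].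
exact: ternary_sumD_block (b_in i) vw (N_in i v) (N_in i w).
Qed.

Lemma sum_index_copies_K4_leq n s :
  (sum_index (copies n (complete_graph 4)) <= s) = (n <= half_triples s).
Proof.
apply/idP/idP => [/sum_index_leqP[f f_inj f_le]|/exists_labeling_leq].
  exact: leq_trans (copies_leq_half_triples f_inj) (half_triples_homo f_le).
by move/sum_index_leqP.
Qed.

Theorem theorem2p6 (n : nat) (hn : 1 <= n) :
  (exists! s : nat, 0 < s /\
     'C((s - 1)./2, 3) + 'C(uphalf (s - 1), 3) < n <= 'C(s./2, 3) + 'C(uphalf s, 3)) /\
  (forall s : nat, 0 < s ->
     'C((s - 1)./2, 3) + 'C(uphalf (s - 1), 3) < n <= 'C(s./2, 3) + 'C(uphalf s, 3) ->
     sum_index (copies n (complete_graph 4)) = s).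
Proof.
set S := sum_index _.
have bracketE s : 0 < s ->
    ('C((s - 1)./2, 3) + 'C(uphalf (s - 1), 3) < n
       <= 'C(s./2, 3) + 'C(uphalf s, 3)) = (S == s).
  move=> s_gt0; rewrite -!/(half_triples _) ltnNge -!sum_index_copies_K4_leq.
  by rewrite -/S -ltnNge subn1 prednK // eqn_leq andbC.
have S_gt0 : 0 < S by rewrite ltnNge sum_index_copies_K4_leq -ltnNge.
split; last by move=> s /bracketE-> /eqP.
exists S; split; first by rewrite bracketE.
by move=> s [/bracketE-> /eqP].
Qed.
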